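(* Let $K$ be a field, let $q \geq 3$ be an integer, and let $G$ be a finite connected simple bipartite graph. If the edge ring $K[G]$ has a $q$-linear resolution, then $K[G]$ is a hypersurface.
   Context: Let $G$ be a finite simple graph (no loops, no multiple edges) on the vertex set $[N]=\{1,\ldots,N\}$ with edge set $E(G)=\{e_1,\ldots,e_n\}$. Let $\mathbf{e}_1,\ldots,\mathbf{e}_N$ be the canonical unit coordinate vectors of $\mathbb{R}^N$, and for an edge $e=\{i,j\}$ put $\rho(e)=\mathbf{e}_i+\mathbf{e}_j$. For $\mathbf{a}=(a_1,\ldots,a_N)\in\mathbb{Z}^N$ write $\mathbf{t}^{\mathbf{a}}=t_1^{a_1}\cdots t_N^{a_N}$. The edge ring $K[G]$ is the $K$-subalgebra of the Laurent polynomial ring $K[t_1^{\pm 1},\ldots,t_N^{\pm 1},s]$ generated by the monomials $\mathbf{t}^{\rho(e_1)}s,\ldots,\mathbf{t}^{\rho(e_n)}s$. Let $S=K[x_1,\ldots,x_n]$ with each $\deg x_i=1$, and let $\pi:S\to K[G]$ be the surjective ring homomorphism with $\pi(x_i)=\mathbf{t}^{\rho(e_i)}s$. The toric ideal is $I_G=\ker\pi$, so $K[G]\cong S/I_G$. For a homogeneous ideal $I\subset S$ let $$0 \to \bigoplus_{j \geq 1} S(-j)^{\beta_{h, j}} \to \cdots \to \bigoplus_{j \geq 1} S(-j)^{\beta_{1, j}} \to S \to S/I \to 0$$ be the graded minimal free $S$-resolution of $S/I$. One says that $S/I$ has a $q$-linear resolution if $\beta_{i,j}=0$ for each $1\leq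 i\leq h$ and each $j\neq q+i-1$. That $K[G]$ has a $q$-linear resolution means that $S/I_G$ does. That $K[G]$ is a hypersurface means that the toric ideal $I_G$ is principal. *)

(* Defs.v *)
From HB Require Import structures.
From mathcomp Require Import all_boot all_order all_algebra.
From mathcomp Require Import mpoly.

Set Implicit Arguments.
Unset Strict Implicit.
Unset Printing Implicit Defensive.

Import GRing.Theory.
Local Open Scope ring_scope.

Record sgraph (N : nat) := SGraph {
  adj : rel 'I_N;
  adj_sym : ssrbool.symmetric adj;
  adj_irr : irreflexive adj }.

Section Graphs.
Variables (N : nat) (G : sgraph N).

Definition edges : {set {set 'I_N}} :=
  [set [set uv.1; uv.2] | uv : 'I_N * 'I_N & adj G uv.1 uv.2].

Definition nedges : nat := #|edges|.

Definition edge (k : 'I_nedges) : {set 'I_N} := enum_val k.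

(* the empty graph is not connected *)
Definition connected : Prop :=
  (0 < N)%N /\ forall u v : 'I_N, connect (adj G) u v.

Definition bipartite : Prop :=
  exists A : {set 'I_N}, forall u v, adj G u v -> (u \in A) != (v \in A).

End Graphs.

Section ToricIdeal.
Variables (K : fieldType) (N : nat) (G : sgraph N).

(* rho {i, j} = e_i + e_j, written as an exponent vector *)
Definition rho (e : {set 'I_N}) : 'X_{1..N} := (\sum_(v in e) U_(v))%MM.

(* The generators t^rho(e) s of the edge ring. The exponents rho(e) are
   nonnegative, so the edge ring lies in the subring K[t_1, ..., t_N][s] of
   K[t_1^{+-1}, ..., t_N^{+-1}, s]; here s is the variable of the outer
   univariate polynomial ring. *)
Definition edge_monomial (k : 'I_(nedges G)) : {poly {mpoly K[N]}} :=
  'X_[rho (edge k)] *: 'X.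

(* the K-algebra morphism pi : K[x_1, ..., x_n] -> K[t_1, ..., t_N][s] that
   sends x_k to t^rho(e_k) s; its image is the edge ring K[G] *)
Definition toric_map : {mpoly K[nedges G]} -> {poly {mpoly K[N]}} :=
  mmap (@polyC {mpoly K[N]} \o @mpolyC N K) edge_monomial.

Definition toric_ideal : {pred {mpoly K[nedges G]}} :=
  [pred p | toric_map p == 0].

End ToricIdeal.

Arguments toric_map K {N} G p.
Arguments toric_ideal K {N} G p.

Section Resolutions.
Variables (K : fieldType) (n : nat).
Local Notation S := {mpoly K[n]}.

(* A list of shifts [:: a_1; ...; a_r] stands for the graded free module
   S(-a_1) (+) ... (+) S(-a_r). A complex F_h -> ... -> F_1 -> F_0 = S of such
   modules is given by the list D of the shifts of F_1, ..., F_h, and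
   F_i = 0 for i > h. *)
Definition shifts (D : seq (seq nat)) (i : nat) : seq nat :=
  nth [::] ([:: 0%N] :: D) i.

Definition betti (D : seq (seq nat)) (i j : nat) : nat :=
  count_mem j (shifts D i).

(* Elements of F_i are row vectors, and the differential F_(i+1) -> F_i is
   v |-> v *m phi i. *)
Definition differentials (D : seq (seq nat)) : Type :=
  forall i : nat, 'M[S]_(size (shifts D i.+1), size (shifts D i)).

Record minimal_graded_free_resolution
    (I : {pred S}) (D : seq (seq nat)) (phi : differentials D) : Prop := {
  (* the differentials are homogeneous of degree 0 *)
  res_graded : forall i r c m, m \in msupp (phi i r c) ->
    (mdeg m + nth 0 (shifts D i) c = nth 0 (shifts D i.+1) r)%N;
  (* the cokernel of F_1 -> F_0 = S is S/I *)
  res_coker : forall p : S,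
    p \in I <-> exists w, w *m phi 0%N = const_mx p :> 'rV_1;
  res_exact : forall i (v : 'rV_(size (shifts D i.+1))),
    v *m phi i = 0 <-> exists w, v = w *m phi i.+1;
  (* the image of F_(i+1) lies in (x_1, ..., x_n) F_i *)
  res_minimal : forall i r c, (phi i r c)@_0%MM = 0 }.

Definition has_linear_resolution (q : nat) (I : {pred S}) : Prop :=
  exists (D : seq (seq nat)) (phi : differentials D),
    minimal_graded_free_resolution I phi /\
    forall i j : nat, (1 <= i <= size D)%N -> j <> (q + i - 1)%N ->
      betti D i j = 0%N.

Definition principal_ideal (I : {pred S}) : Prop :=
  exists f : S, forall p : S, p \in I <-> exists g : S, p = g * f.

End Resolutions.

Definition edge_ring_linear (K : fieldType) (N : nat) (G : sgraph N)
    (q : nat) : Prop :=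
  has_linear_resolution q (toric_ideal K G).

Definition edge_ring_hypersurface (K : fieldType) (N : nat) (G : sgraph N)
    : Prop :=
  principal_ideal (toric_ideal K G).

(* Main.v *)
Require Import Defs.
From mathcomp Require Import all_boot all_algebra.
From mathcomp Require Import mpoly zify.

Set Implicit Arguments.
Unset Strict Implicit.
Unset Printing Implicit Defensive.

(** Write I for the toric ideal and identify a monomial x^u with its exponent
u, a multiset of edges. The ideal I is spanned by the binomials x^u - x^v for
which u and v are congruent, that is, have the same degree at every vertex.
A q-linear resolution says two things: I is generated in degree q, so
congruent u and v of degree less than q are equal; and the syzygies of the
generators are generated by linear ones.

Combinatorics. Let u <> v be congruent of degree q. Starting from a vertex,
follow alternately an edge of u and an edge of v; in a bipartite graph the walk
closes up to a cycle whose two perfect matchings are congruent, so by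
minimality of q they are u and v (nontrivial_cong_cycle). A chord of this
cycle would cut off a shorter one, so the cycle is chordless
(nontrivial_cong_chordless), and v is the only other multiset congruent to u
(nontrivial_cong_unique).

Linear syzygies. Fix such a pair u, v and take the coefficients of x^u in the
generators. Applied to the linear syzygies they give linear forms
(syz_coeff u). If x_e occurs in one of these forms, then u + e = w + k for an
edge k <> e and another multiset w with a congruent partner w' <> w
(syz_coeff_exchange). As the cycles of u and w are chordless and, since q >= 3,
no two relations of degree 2 exist, e and k have no common endpoint, and hence
e is disjoint from the cycle of u (exchange_edge_disjoint).

Koszul syzygies. Let y, y' be a congruent pair not congruent to u. The Koszul
syzygy between x^u - x^v and x^y - x^y' is a combination of the linear ones;
comparing coefficients of x^y shows that some x_e that occurs in syz_coeff u
divides x^y (koszul_monomial). Use this twice. First, it yields an exchange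
u + e = w + k as above. Then use it with y := w' and y' := w. The cycle of w
arises from that of u by removing the endpoints of k and adding those of e.
As e belongs to w, it does not belong to w', so every edge of w' touches the
cycle of u. But some edge of w' must be disjoint from it: a contradiction.

So all congruent pairs of degree q belong to one congruence class, which has
two elements u and v only, and x^u - x^v generates I. *)

(** * Endpoint degrees and congruent multisets of edges *)

Section EndpointDegree.
Variables (n : nat) (V : finType).
Implicit Types (f L R : 'I_n -> V) (u v w : 'X_{1..n}) (g : 'I_n).

(** With 'I_n the set of edges, u a multiset of edges and f one of the two
endpoint maps of a bipartite graph, this is the degree at the vertex x of the
multigraph with edge multiset u. *)
Definition endpoint_degree f u (x : V) : nat := \sum_(k | f k == x) u k.

Lemma endpoint_degreeD f u v x :
  endpoint_degree f (u + v) x = endpoint_degree f u x + endpoint_degree f v x.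
Proof. by rewrite -big_split /=; apply: eq_bigr => k _; rewrite mnmDE. Qed.

Lemma endpoint_degree1 f g x : endpoint_degree f U_(g)%MM x = (f g == x).
Proof.
rewrite /endpoint_degree; case: eqP => [<-|ne_gx] /=.
  rewrite (bigD1 g) //= mnm1E eqxx big1 // => k /andP[_ ne_kg].
  by rewrite mnm1E eq_sym (negbTE ne_kg).
rewrite big1 // => k /eqP fk; rewrite mnm1E; case: eqP => // gk.
by rewrite gk in ne_gx.
Qed.

Lemma endpoint_degree_sum f (p : nat) (a : nat -> 'I_n) x :
  endpoint_degree f (\sum_(i < p) U_(a i))%MM x = \sum_(i < p) (f (a i) == x).
Proof.
rewrite (big_morph (fun u => endpoint_degree f u x) (id1 := 0) (op1 := addn)).
- by apply: eq_bigr => i _; rewrite endpoint_degree1.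
- by move=> u v; rewrite endpoint_degreeD.
- by rewrite /endpoint_degree big1 // => k _; rewrite mnm0E.
Qed.

Lemma leq_endpoint_degree f u g : u g <= endpoint_degree f u (f g).
Proof. by rewrite /endpoint_degree (bigD1 g) //= leq_addr. Qed.

Lemma leq_endpoint_degree2 f u g h :
  g != h -> f g = f h -> u g + u h <= endpoint_degree f u (f g).
Proof.
move=> ne_gh fgh; rewrite /endpoint_degree (bigD1 g) //= (bigD1 h) /=.
  by rewrite addnA leq_addr.
by rewrite fgh eqxx eq_sym.
Qed.

Lemma endpoint_degree_gt0 f u x :
  0 < endpoint_degree f u x -> exists2 g, f g = x & 0 < u g.
Proof.
rewrite lt0n sum_nat_eq0 => /forallPn[g]; rewrite negb_imply -lt0n.
by case/andP=> /eqP; exists g.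
Qed.

Lemma sum_endpoint_degree f u : \sum_x endpoint_degree f u x = mdeg u.
Proof. by rewrite mdegE (partition_big f predT). Qed.

(** The binomial x^u - x^v lies in the toric ideal exactly when u and v are
congruent in this sense. Left and right vertices are counted separately, so
that L and R may be arbitrary maps to one vertex type. *)
Definition cong L R u v :=
  endpoint_degree L u =1 endpoint_degree L v
  /\ endpoint_degree R u =1 endpoint_degree R v.

Lemma cong_sym L R u v : cong L R u v -> cong L R v u.
Proof. by case=> EL ER; split=> x; rewrite ?EL ?ER. Qed.

Lemma cong_trans L R u v w : cong L R u v -> cong L R v w -> cong L R u w.
Proof. by move=> [EL ER] [FL FR]; split=> x; rewrite ?EL ?ER. Qed.

Lemma cong_mdeg L R u v : cong L R u v -> mdeg u = mdeg v.
Proof.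
by case=> EL _; rewrite -!(sum_endpoint_degree L); apply: eq_bigr => x _.
Qed.

Lemma cong_addr L R u v w : cong L R (u + w) (v + w) -> cong L R u v.
Proof.
case=> EL ER; split=> x.
- by have := EL x; rewrite !endpoint_degreeD => /addIn.
- by have := ER x; rewrite !endpoint_degreeD => /addIn.
Qed.

Lemma mnm_gt0_subK u g : 0 < u g -> (u - U_(g) + U_(g))%MM = u.
Proof.
move=> ug; apply: submK; apply/mnm_lepP => k; rewrite mnm1E.
by case: eqP => // <-.
Qed.

Lemma mnm_le_eq u v : (forall g, u g <= v g) -> mdeg u = mdeg v -> u = v.
Proof.
move=> le_uv; have /submK <- : (u <= v)%MM by apply/mnm_lepP.
rewrite mdegD -{1}[mdeg u]add0n => /addIn/esym/eqP.
by rewrite mdeg_eq0 => /eqP->; rewrite add0m.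
Qed.

End EndpointDegree.

Lemma sum_mnm1_le n p (a : nat -> 'I_n) (u : 'X_{1..n}) :
  (forall i, 0 < u (a i)) ->
  (forall i j, i < p -> j < p -> a i = a j -> i = j) ->
  forall g, (\sum_(i < p) U_(a i))%MM g <= u g.
Proof.
move=> ua a_inj g; rewrite mnm_sumE.
under eq_bigr do rewrite mnm1E.
case: (pickP (fun i : 'I_p => a i == g)) => [i /eqP Eg|no]; last first.
  by rewrite big1 // => i _; rewrite no.
rewrite (bigD1 i) //= big1 => [|j ne_ji]; first by rewrite -Eg eqxx addn0.
case: eqP => // Ej; case/eqP: ne_ji; apply: val_inj.
by apply: a_inj; rewrite //= Eg Ej.
Qed.

Lemma sum_cycle_shift p (F : nat -> nat) : F p = F 0 ->
  \sum_(i < p) F i.+1 = \sum_(i < p) F i.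
Proof.
case: p => [|p] Fp; first by rewrite !big_ord0.
by rewrite big_ord_recr big_ord_recl /= Fp addnC.
Qed.

Lemma sum_eq_le1 (V : eqType) p (F : nat -> V) x :
  (forall i j, i < p -> j < p -> F i = F j -> i = j) ->
  \sum_(i < p) (F i == x) <= 1.
Proof.
move=> F_inj.
case: (pickP (fun i : 'I_p => F i == x)) => [i /eqP Ei|no]; last first.
  by rewrite big1 // => i _; rewrite no.
rewrite (bigD1 i) //= big1 => [|j ne_ji]; first by case: eqP.
case: eqP => // Ej; case/eqP: ne_ji; apply: val_inj.
by apply: F_inj; rewrite //= Ei Ej.
Qed.

(** The closed walk L(a 0), R(a 0), L(a 1), R(a 1), ... of length 2p, whose
edges a i and b i are taken from u and v in turn. Indexing by all natural
numbers and asking for periodicity makes rotations of the cycle immediate. *)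
Record alternating_cycle n (V : finType) (L R : 'I_n -> V) (u v : 'X_{1..n})
    (p : nat) (a b : nat -> 'I_n) : Prop := {
  cycle_even : forall i, 0 < u (a i);
  cycle_odd : forall i, 0 < v (b i);
  cycle_R : forall i, R (b i) = R (a i);
  cycle_L : forall i, L (b i) = L (a i.+1);
  cycle_periodic : forall i, a (i + p) = a i;
  cycle_L_inj : forall i j, i < p -> j < p -> L (a i) = L (a j) -> i = j;
  cycle_R_inj : forall i j, i < p -> j < p -> R (a i) = R (a j) -> i = j }.

(** The first repetition in the trajectory of x ends a periodic orbit, on which
the iterates before the period are pairwise distinct. *)
Lemma iter_periodic_point (T : finType) (f : T -> T) (x : T) :
  exists k p, [/\ 0 < p, iter p f (iter k f x) = iter k f x
    & forall i j, i < p -> j < p ->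
        iter i f (iter k f x) = iter j f (iter k f x) -> i = j].
Proof.
have /loopingP/(_ (fingraph.order f x))/trajectP[k lt_k Ek] :=
  looping_order f x.
exists k, (fingraph.order f x - k); split.
- by rewrite subn_gt0.
- by rewrite -iterD subnK // ltnW.
move=> i j lti ltj; rewrite -!iterD => E.
have U := orbit_uniq f x; rewrite /orbit in U.
have lti' : i + k < fingraph.order f x by lia.
have ltj' : j + k < fingraph.order f x by lia.
apply/(@addIn k)/eqP.
rewrite -(nth_uniq x _ _ U) ?size_traject //.
by rewrite !nth_traject // E.
Qed.

(** A vertex that is met by an edge of u is met by an edge of v, and conversely.
Choosing one such edge per vertex turns walking two steps along the
multigraph into a self-map of the left vertices, and a periodic orbit of this
map is the cycle. The choice depends on the vertex alone, so the right
vertices of the cycle are distinct because the left ones are. *)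
Lemma exists_alternating_cycle n (V : finType) (L R : 'I_n -> V)
    (u v : 'X_{1..n}) :
  cong L R u v -> u <> 0%MM ->
  exists p a b, 0 < p /\ alternating_cycle L R u v p a b.
Proof.
move=> [EL ER] /eqP; rewrite -mdeg_eq0 -lt0n => u_gt0.
have [g0 ug0] : exists g, 0 < u g.
  move: u_gt0; rewrite mdegE lt0n sum_nat_eq0 => /forallPn[g].
  by rewrite -lt0n; exists g.
pose al x := odflt g0 [pick g | (L g == x) && (0 < u g)].
pose be y := odflt g0 [pick g | (R g == y) && (0 < v g)].
have alP x : 0 < endpoint_degree L u x -> L (al x) = x /\ 0 < u (al x).
  case/endpoint_degree_gt0=> g Lg ug; rewrite /al; case: pickP => [h|/(_ g)].
    by case/andP=> /eqP.
  by rewrite Lg eqxx ug.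
have beP y : 0 < endpoint_degree R v y -> R (be y) = y /\ 0 < v (be y).
  case/endpoint_degree_gt0=> g Rg vg; rewrite /be; case: pickP => [h|/(_ g)].
    by case/andP=> /eqP.
  by rewrite Rg eqxx vg.
(* One edge of u from a left vertex, then one edge of v back to the left. *)
pose s x := L (be (R (al x))).
have be_al x : 0 < endpoint_degree L u x ->
    R (be (R (al x))) = R (al x) /\ 0 < v (be (R (al x))).
  case/alP=> _ ual; apply: beP; rewrite -ER.
  exact: leq_trans ual (leq_endpoint_degree _ _ _).
have s_gt0 x : 0 < endpoint_degree L u x -> 0 < endpoint_degree L u (s x).
  case/be_al=> _ vb; rewrite EL.
  exact: leq_trans vb (leq_endpoint_degree _ _ _).
have x0_gt0 : 0 < endpoint_degree L u (L g0).
  exact: leq_trans ug0 (leq_endpoint_degree _ _ _).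
have iter_gt0 i : 0 < endpoint_degree L u (iter i s (L g0)).
  by elim: i => //= i; apply: s_gt0.
have [k [p [p_gt0 Ep inj_p]]] := iter_periodic_point s (L g0).
pose l i := iter i s (iter k s (L g0)).
have l_gt0 i : 0 < endpoint_degree L u (l i) by rewrite /l -iterD.
have lD i : l (i + p) = l i by rewrite /l iterD Ep.
exists p, (al \o l), (be \o R \o al \o l); split=> //; split=> /=.
- by move=> i; have [] := alP _ (l_gt0 i).
- by move=> i; have [] := be_al _ (l_gt0 i).
- by move=> i; have [] := be_al _ (l_gt0 i).
- by move=> i; have [-> _] := alP _ (l_gt0 i.+1).
- by move=> i; rewrite lD.
- move=> i j lti ltj.
  have [-> _] := alP _ (l_gt0 i); have [-> _] := alP _ (l_gt0 j); exact: inj_p.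
move=> i j lti ltj E; apply: inj_p => //; rewrite -![iter _ _ _]lD.
have {}E : l i.+1 = l j.+1 by rewrite /l /= {1 3}/s E.
(* Going p - 1 steps further brings a coincidence at i + 1 and j + 1 back to
   i and j. *)
have shift m : l (m + p) = iter p.-1 s (l m.+1).
  by rewrite /l -[RHS]iterD; congr iter; lia.
by rewrite !shift E.
Qed.

(** * Relations of the least possible degree *)

Section MinimalRelations.
Variables (n : nat) (V : finType) (L R : 'I_n -> V) (q : nat).
Hypothesis LR_inj : forall g h, L g = L h -> R g = R h -> g = h.
Hypothesis cong_small :
  forall u v : 'X_{1..n}, cong L R u v -> mdeg u < q -> u = v.
Implicit Types (u v w : 'X_{1..n}) (g e k : 'I_n).

Definition nontrivial_cong u v := [/\ cong L R u v, u <> v & mdeg u = q].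

Lemma nontrivial_cong_sym u v : nontrivial_cong u v -> nontrivial_cong v u.
Proof.
case=> Cuv ne_uv du; split; [exact: cong_sym | exact: nesym |].
by rewrite -(cong_mdeg Cuv).
Qed.

(** A common edge could be removed from both sides, leaving a relation of
degree q - 1. *)
Lemma nontrivial_cong_disjoint u v g :
  nontrivial_cong u v -> 0 < u g -> v g = 0.
Proof.
case=> Cuv ne_uv du ug; apply/eqP; rewrite -leqn0 leqNgt; apply/negP => vg.
have Eu := mnm_gt0_subK ug; have Ev := mnm_gt0_subK vg.
apply: ne_uv; rewrite -Eu -Ev; congr (_ + _)%MM; apply: cong_small.
  by apply: (@cong_addr _ _ _ _ _ _ U_(g)%MM); rewrite Eu Ev.
by rewrite -du -[in X in _ < X]Eu mdegD mdeg1 addn1.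
Qed.

(** The two perfect matchings of an alternating cycle inside u and v are
congruent, so they have degree at least q and exhaust u and v. *)
Lemma nontrivial_cong_cycle u v :
  nontrivial_cong u v ->
  exists a b, [/\ alternating_cycle L R u v q a b,
    u = (\sum_(i < q) U_(a i))%MM & v = (\sum_(i < q) U_(b i))%MM].
Proof.
move=> uv; have [Cuv ne_uv du] := uv.
have [p [a [b [p_gt0 C]]]] :
    exists p a b, 0 < p /\ alternating_cycle L R u v p a b.
  apply: exists_alternating_cycle => // u0; apply: ne_uv; rewrite u0.
  have /eqP : mdeg v = 0 by rewrite -(cong_mdeg Cuv) u0 mdeg0.
  by rewrite mdeg_eq0 => /eqP.
pose u' := (\sum_(i < p) U_(a i))%MM; pose v' := (\sum_(i < p) U_(b i))%MM.
have Cuv' : cong L R u' v'.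
  split=> x; rewrite !endpoint_degree_sum; last first.
    by apply: eq_bigr => i _; rewrite (cycle_R C).
  under [RHS]eq_bigr => i _ do rewrite (cycle_L C).
  rewrite (@sum_cycle_shift p (fun i => L (a i) == x)) //.
  by rewrite -[in LHS](add0n p) (cycle_periodic C).
have le_u : forall g, u' g <= u g.
  apply: sum_mnm1_le; first exact: cycle_even C.
  by move=> i j lti ltj E; apply: (cycle_L_inj C) => //; rewrite E.
have le_v : forall g, v' g <= v g.
  apply: sum_mnm1_le; first exact: cycle_odd C.
  move=> i j lti ltj E; apply: (cycle_R_inj C) => //.
  by rewrite -!(cycle_R C) E.
have du' : mdeg u' = p.
  rewrite mdeg_sum -[RHS]mul1n -[RHS]/(1 * p) mulnC -[in RHS](card_ord p).
  by rewrite -sum_nat_const; apply: eq_bigr => i _; rewrite mdeg1.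
have ne_uv' : u' <> v'.
  have ua : 0 < u' (a 0).
    by rewrite mnm_sumE (bigD1 (Ordinal p_gt0)) //= mnm1E eqxx.
  move=> E; have := le_v (a 0); rewrite -E.
  rewrite (nontrivial_cong_disjoint uv (cycle_even C 0)).
  by rewrite leqn0 => /eqP E0; rewrite E0 in ua.
have le_pq : p <= q.
  rewrite -du -du' !mdegE; apply: leq_sum => i _; exact: le_u.
have Epq : p = q.
  apply/eqP; rewrite eqn_leq le_pq leqNgt; apply/negP => lt_pq.
  by apply: ne_uv'; apply: cong_small; rewrite ?du'.
move: C le_u le_v Cuv' du'; rewrite /u' /v' Epq => C le_u le_v Cuv' du'.
exists a, b; split=> //.
- by apply/esym/mnm_le_eq => //; rewrite du du'.
- apply/esym/mnm_le_eq => //; rewrite -(cong_mdeg Cuv).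
  by rewrite -(cong_mdeg Cuv') du du'.
Qed.

Lemma nontrivial_cong_degree_le1 u v x :
  nontrivial_cong u v ->
  endpoint_degree L u x <= 1 /\ endpoint_degree R u x <= 1.
Proof.
case/nontrivial_cong_cycle=> a [b [C -> _]]; rewrite !endpoint_degree_sum.
split.
- exact: (@sum_eq_le1 _ q (L \o a) x (cycle_L_inj C)).
- exact: (@sum_eq_le1 _ q (R \o a) x (cycle_R_inj C)).
Qed.

(** Let g join L(a i) to R(a (i + t)) on the cycle of u and v. The arc between
these vertices has the edges a i, ..., a (i + t) of u; the edges of v on it
together with g have the same vertex degrees. So, when t + 1 < q, they are
equal as multisets and g is one of the edges of u. When t + 1 = q the arc
misses a single edge of the cycle, which is an edge of v parallel to g. *)
Lemma nontrivial_cong_chordless u v g :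
  nontrivial_cong u v ->
  0 < endpoint_degree L u (L g) -> 0 < endpoint_degree R u (R g) ->
  0 < u g \/ 0 < v g.
Proof.
move=> uv; have [a [b [C Eu Ev]]] := nontrivial_cong_cycle uv.
have pos f : 0 < endpoint_degree f u (f g) -> exists2 i, i < q & f (a i) = f g.
  rewrite [in X in X -> _]Eu endpoint_degree_sum lt0n sum_nat_eq0.
  case/forallPn=> i /=.
  by case: (f (a i) =P f g) => // E _; exists i.
case/pos=> i lti Li /pos[j0 ltj0 Rj0].
(* The position of R g is counted forward from that of L g, going once around
   if necessary. *)
have [t ltt Rj] : exists2 t, t < q & R (a (i + t)) = R g.
  case: (leqP i j0) => [le_ij|lt_ji].
    by exists (j0 - i); [lia | rewrite subnKC].
  exists (j0 + q - i); first by lia.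
  by rewrite subnKC ?(cycle_periodic C) //; lia.
pose A := (\sum_(s < t.+1) U_(a (i + s)%N))%MM.
pose B := (U_(g) + \sum_(s < t) U_(b (i + s)%N))%MM.
have CAB : cong L R A B.
  split=> x; rewrite endpoint_degreeD endpoint_degree1.
    rewrite (endpoint_degree_sum L t.+1 (fun s => a (i + s))).
    rewrite (endpoint_degree_sum L t (fun s => b (i + s))).
    rewrite big_ord_recl /= addn0 Li.
    congr (_ + _); apply: eq_bigr => s _.
    by rewrite (cycle_L C) addnS.
  rewrite (endpoint_degree_sum R t.+1 (fun s => a (i + s))).
  rewrite (endpoint_degree_sum R t (fun s => b (i + s))).
  rewrite big_ord_recr /= Rj addnC.
  congr (_ + _); apply: eq_bigr => s _.
  by rewrite (cycle_R C).
have dA : mdeg A = t.+1.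
  rewrite /A mdeg_sum; under eq_bigr do rewrite mdeg1.
  by rewrite sum_nat_const card_ord muln1.
have [lt_tq|le_qt] := ltnP t.+1 q.
  have EAB : A = B by apply: cong_small; rewrite ?dA.
  have : 0 < A g by rewrite EAB mnmDE mnm1E eqxx.
  rewrite mnm_sumE lt0n sum_nat_eq0 => /forallPn[s] /=.
  rewrite mnm1E; case: (_ =P g) => // <- _; left; exact: cycle_even C _.
have Et : t.+1 = q by lia.
right; suff -> : g = b (i + t) by exact: cycle_odd C _.
apply: LR_inj; last by rewrite (cycle_R C) Rj.
by rewrite (cycle_L C) -addnS Et (cycle_periodic C) Li.
Qed.

Lemma nontrivial_cong_mnm_le1 u v g : nontrivial_cong u v -> u g <= 1.
Proof.
move/(nontrivial_cong_degree_le1 (L g))=> [le1 _].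
exact: leq_trans (leq_endpoint_degree L u g) le1.
Qed.

(** By chordlessness the edges of w lie on the cycle of u and v; being disjoint
from u, they are edges of v. *)
Lemma nontrivial_cong_unique u v w :
  nontrivial_cong u v -> cong L R u w -> w <> u -> w = v.
Proof.
move=> uv Cuw ne_wu; have [Cuv _ du] := uv.
have uw : nontrivial_cong u w by split=> //; apply: nesym.
have wu := nontrivial_cong_sym uw.
apply: mnm_le_eq => [g|]; last by rewrite -(cong_mdeg Cuw) (cong_mdeg Cuv).
case: (posnP (w g)) => [->//|wg].
apply: leq_trans (nontrivial_cong_mnm_le1 g wu) _.
have [EL ER] := Cuw.
have [||ug|//] := @nontrivial_cong_chordless u v g uv.
- rewrite EL; exact: leq_trans wg (leq_endpoint_degree _ _ _).
- rewrite ER; exact: leq_trans wg (leq_endpoint_degree _ _ _).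
by rewrite (nontrivial_cong_disjoint uw ug) in wg.
Qed.

(** The multigraph w arises from u by replacing the edge k by e, and both have
a congruent partner. This is the shape of the linear syzygies, see
syz_coeff_exchange. *)
Section Exchange.
Variables (u v w w' : 'X_{1..n}) (e k : 'I_n).
Hypotheses (uv : nontrivial_cong u v) (ww' : nontrivial_cong w w').
Hypotheses (ke : k <> e) (exch : (u + U_(e) = w + U_(k))%MM).

Lemma exchange_mnm g : u g + (e == g) = w g + (k == g).
Proof.
by have := congr1 (fun m : 'X_{1..n} => m g) exch; rewrite !mnmDE !mnm1E.
Qed.

Lemma exchange_degree (f : 'I_n -> V) x :
  endpoint_degree f u x + (f e == x) = endpoint_degree f w x + (f k == x).
Proof.
have := congr1 (fun m : 'X_{1..n} => endpoint_degree f m x) exch.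
by rewrite !endpoint_degreeD !endpoint_degree1.
Qed.

(** If k and e had a common left endpoint, then the cycles of u and w would
differ only by having R k or R e as a vertex. Let ep be the edge of w' at
R e. The other edges of w' join vertices of u, so by chordlessness they are in
u or v; and not in u, whose edges other than k belong to w. So v arises from
w' by replacing ep by an edge ta, which must join L ep to R k. Then k, ep, ta,
e form a 4-cycle, a relation of degree 2. *)
Lemma exchange_no_common_L : 3 <= q -> L k <> L e.
Proof.
move=> q_ge3 Lke.
have Rke : R k <> R e by move=> Rke; apply/ke/LR_inj.
have /eqP/negbTE ke' := ke; have /eqP/negbTE Rke' := Rke.
have [Cww' _ dw] := ww'; have [ELw ERw] := Cww'.
have [Cuv _ du] := uv; have [ELu ERu] := Cuv.
have w'w := nontrivial_cong_sym ww'.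
have uk : 0 < u k by have := exchange_mnm k; rewrite eqxx [e == k]eq_sym ke'; lia.
have we : 0 < w e by have := exchange_mnm e; rewrite eqxx ke'; lia.
have Lu x : endpoint_degree L u x = endpoint_degree L w x.
  by have := exchange_degree L x; rewrite Lke => /addIn.
have Rw'k : endpoint_degree R w' (R k) = 0.
  have := exchange_degree R (R k); rewrite eqxx [R e == _]eq_sym Rke' -ERw.
  by have [_] := nontrivial_cong_degree_le1 (R k) uv; lia.
have [ep Rep w'ep] : exists2 g, R g = R e & 0 < w' g.
  apply: endpoint_degree_gt0; rewrite -ERw.
  exact: leq_trans we (leq_endpoint_degree _ _ _).
have in_v g : g != ep -> 0 < w' g -> 0 < v g.
  move=> ne_g w'g.
  have Rge : R e == R g = false.
    apply/eqP => Rge.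
    have := leq_endpoint_degree2 w' ne_g (etrans (esym Rge) (esym Rep)).
    by have [_] := nontrivial_cong_degree_le1 (R g) w'w; lia.
  have [||ug|//] := @nontrivial_cong_chordless u v g uv.
  - by rewrite Lu ELw; apply: leq_trans w'g (leq_endpoint_degree _ _ _).
  - have := exchange_degree R (R g); rewrite Rge ERw.
    by have := leq_endpoint_degree R w' g; lia.
  have := exchange_mnm g; have := nontrivial_cong_disjoint w'w w'g.
  case: (k =P g) => [Ekg|_]; last by lia.
  have := leq_endpoint_degree R w' g; rewrite -Ekg Rw'k.
  by rewrite -Ekg in w'g; lia.
have le_w'v : (w' - U_(ep) <= v)%MM.
  apply/mnm_lepP => g; rewrite mnmBE mnm1E.
  have := nontrivial_cong_mnm_le1 g w'w.
  case: (ep =P g) => [_|ne_g]; first by lia.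
  case: (posnP (w' g)) => [->//|w'g].
  by have /in_v := w'g; move=> /(_ (introN eqP (nesym ne_g))); lia.
have Ew' := mnm_gt0_subK w'ep; have Ev := submK le_w'v.
have : mdeg (v - (w' - U_(ep)))%MM == 1.
  have := congr1 (fun m : 'X_{1..n} => mdeg m) Ev.
  have := congr1 (fun m : 'X_{1..n} => mdeg m) Ew'.
  by rewrite !mdegD mdeg1 -(cong_mdeg Cww') -(cong_mdeg Cuv) du dw; lia.
case/mdeg1P=> ta /eqP Eta; rewrite {}Eta in Ev.
have vta : 0 < v ta by rewrite -Ev mnmDE mnm1E eqxx.
have Lta : L ta = L ep.
  have : endpoint_degree L v (L ta) = endpoint_degree L w' (L ta).
    by rewrite -ELu Lu ELw.
  rewrite -Ev -[in RHS]Ew' !endpoint_degreeD !endpoint_degree1 eqxx addnC.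
  by case: eqP => // _; lia.
have Rta : R ta = R k.
  have : 0 < endpoint_degree R v (R k).
    by rewrite -ERu; apply: leq_trans uk (leq_endpoint_degree _ _ _).
  rewrite -Ev endpoint_degreeD endpoint_degree1; case: eqP => // _.
  by move: Rw'k; rewrite -[w' in LHS]Ew' endpoint_degreeD; lia.
have E4 : (U_(k) + U_(ep) = U_(ta) + U_(e))%MM.
  apply: cong_small; last by rewrite mdegD !mdeg1.
  split=> x; rewrite !endpoint_degreeD !endpoint_degree1.
    by rewrite Lta Lke addnC.
  by rewrite Rta Rep.
have := congr1 (fun m : 'X_{1..n} => m k) E4; rewrite !mnmDE !mnm1E eqxx.
rewrite [e == k]eq_sym ke'; case: (ta =P k) => // Etk.
by have := nontrivial_cong_disjoint uv uk; rewrite -Etk; lia.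
Qed.

(** The vertices of w' outside the cycle of u are endpoints of e, so an edge
of w' with no endpoint on this cycle would be e itself. But e lies in w, which
is disjoint from w'. *)
Lemma exchange_touch g : 0 < w' g ->
  endpoint_degree L u (L g) = 0 -> endpoint_degree R u (R g) = 0 -> False.
Proof.
move=> w'g Lu0 Ru0; have [[ELw ERw] _ _] := ww'.
have := exchange_degree L (L g); have := exchange_degree R (R g).
rewrite Lu0 Ru0 ELw ERw.
have := leq_endpoint_degree L w' g; have := leq_endpoint_degree R w' g.
case: (R e =P R g) => [Rg|_]; last by lia.
case: (L e =P L g) => [Lg|_]; last by lia.
have Eg : e = g by exact: LR_inj.
have we : 0 < w e.
  by have := exchange_mnm e; rewrite eqxx; move/eqP/negbTE: ke => ->; lia.
by have := nontrivial_cong_disjoint ww' we; rewrite Eg; lia.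
Qed.

End Exchange.
End MinimalRelations.

Lemma cong_swap n (V : finType) (L R : 'I_n -> V) (u v : 'X_{1..n}) :
  cong L R u v -> cong R L u v.
Proof. by case. Qed.

(** Since e and k have no common endpoint, the endpoints of e have one degree
more in w than in u, and the degrees in w are at most 1. *)
Lemma exchange_edge_disjoint n (V : finType) (L R : 'I_n -> V) (q : nat)
    (u v w w' : 'X_{1..n}) (e k : 'I_n) :
  3 <= q ->
  (forall g h, L g = L h -> R g = R h -> g = h) ->
  (forall u v : 'X_{1..n}, cong L R u v -> mdeg u < q -> u = v) ->
  nontrivial_cong L R q u v -> nontrivial_cong L R q w w' ->
  k <> e -> (u + U_(e) = w + U_(k))%MM ->
  endpoint_degree L u (L e) = 0 /\ endpoint_degree R u (R e) = 0.
Proof.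
move=> q_ge3 LR_inj small uv ww' ke exch.
have Lke : L k <> L e := exchange_no_common_L LR_inj small uv ww' ke exch q_ge3.
have Rke : R k <> R e.
  have swap a b : nontrivial_cong L R q a b -> nontrivial_cong R L q a b.
    by case=> Cab ? ?; split=> //; apply: cong_swap.
  apply: (exchange_no_common_L (L := R) (R := L) _ _ (swap _ _ uv) (swap _ _ ww')
    ke exch q_ge3).
  - by move=> g h Rgh Lgh; apply: LR_inj.
  - by move=> a b /cong_swap Cab; apply: small.
have := exchange_degree exch L (L e); have := exchange_degree exch R (R e).
have [lwL _] := nontrivial_cong_degree_le1 small (L e) ww'.
have [_ lwR] := nontrivial_cong_degree_le1 small (R e) ww'.
by rewrite !eqxx; move/eqP/negbTE: Lke => ->; move/eqP/negbTE: Rke => ->; lia.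
Qed.

(** * Linear presentations of an ideal *)

Import GRing.Theory.
Local Open Scope ring_scope.

Section Coefficients.
Variables (K : fieldType) (n : nat).
Local Notation S := {mpoly K[n]}.
Implicit Types (p h : S) (u m : 'X_{1..n}).

Definition homogeneous (d : nat) p := forall m, m \in msupp p -> mdeg m = d.

Lemma mcoeffM_neq0 p h m : (p * h)@_m != 0 ->
  exists m1 m2, [/\ m = (m1 + m2)%MM, p@_m1 != 0 & h@_m2 != 0].
Proof.
rewrite -mcoeff_msupp => /msuppM_le/allpairsP[[m1 m2] /= [s1 s2 ->]].
by exists m1, m2; rewrite -!mcoeff_msupp.
Qed.

Lemma mcoeffM_homogeneous d (w : S) h u :
  homogeneous d h -> mdeg u = d -> (w * h)@_u = w@_0%MM * h@_u.
Proof.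
move=> hom_h du.
(* A monomial of w other than 1 raises the degree above that of u. *)
rewrite -{1}[w](subrK (w@_0%MM)%:MP_[n]) mulrDl mcoeffD mcoeffCM.
rewrite -[RHS]add0r; congr (_ + _); apply/eqP/negPn/negP.
case/mcoeffM_neq0=> m1 [m2 [Eu w1]]; rewrite -mcoeff_msupp => /hom_h d2.
move: w1; suff -> : m1 = 0%MM by rewrite mcoeffB mcoeffC eqxx mulr1 subrr eqxx.
apply/eqP; rewrite -mdeg_eq0; apply/eqP.
by move: du; rewrite Eu mdegD d2; lia.
Qed.

Lemma homogeneous1E p : homogeneous 1 p -> p = \sum_e p@_U_(e)%MM *: 'X_e.
Proof.
move=> hom_p; apply/mpolyP => m; rewrite raddf_sum /=.
under eq_bigr do rewrite mcoeffZ mcoeffX.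
have [/mdeg1P[e /eqP->]|dm] := boolP (mdeg m == 1%N).
  rewrite (bigD1 e) //= eqxx mulr1 big1 ?addr0 // => k ne_ke.
  rewrite (_ : (U_(k)%MM == U_(e)%MM) = false) ?mulr0 //.
  apply/eqP => /(congr1 (fun m : 'X_{1..n} => m e)).
  by rewrite !mnm1E eqxx (negbTE ne_ke).
rewrite big1 => [|k _].
  by apply/eqP; rewrite mcoeff_eq0; apply/negP => /hom_p/eqP; rewrite (negbTE dm).
case: eqP => [Em|]; last by rewrite mulr0.
by rewrite -Em mdeg1 eqxx in dm.
Qed.

(** The data that a linear resolution gives in homological degrees 1 and 2:
generators f of degree q, and linear syzygies, the rows of M, that generate
all syzygies of f. *)
Record linear_presentation (q : nat) (I : {pred S}) (r s : nat)
    (f : 'I_r -> S) (M : 'I_s -> 'I_r -> S) : Prop := {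
  gen_homogeneous : forall i, homogeneous q (f i);
  gen_ideal : forall p, p \in I <-> exists w : 'I_r -> S, p = \sum_i w i * f i;
  syz_homogeneous : forall t i, homogeneous 1 (M t i);
  syz_generate : forall v : 'I_r -> S, \sum_i v i * f i = 0 <->
    exists y : 'I_s -> S, forall i, v i = \sum_t y t * M t i }.

Arguments gen_homogeneous {q I r s f M} _ i [m].
Arguments syz_homogeneous {q I r s f M} _ t i [m].

Section LinearPresentation.
Variables (q : nat) (I : {pred S}) (r s : nat).
Variables (f : 'I_r -> S) (M : 'I_s -> 'I_r -> S).
Hypothesis P : linear_presentation q I f M.

(** The functional taking a form of degree q to its coefficient at u, applied
to the generators in the t-th linear syzygy. *)
Definition syz_coeff u (t : 'I_s) : S := \sum_i (f i)@_u *: M t i.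

Lemma gen_mem i : f i \in I.
Proof.
apply/(gen_ideal P); exists (fun j => (i == j)%:R).
rewrite (bigD1 i) //= eqxx mul1r big1 ?addr0 // => j ne_ji.
by rewrite eq_sym (negbTE ne_ji) mul0r.
Qed.

Lemma ideal_subM p h (w : S) : p \in I -> h \in I -> p - w * h \in I.
Proof.
move=> /(gen_ideal P)[a ->] /(gen_ideal P)[b ->]; apply/(gen_ideal P).
exists (fun i => a i - w * b i); rewrite mulr_sumr -sumrB.
by apply: eq_bigr => i _; rewrite mulrBl mulrA.
Qed.

Lemma ideal_mdeg_ge p m : p \in I -> m \in msupp p -> (q <= mdeg m)%N.
Proof.
move=> /(gen_ideal P)[w ->] /msupp_sum_le/flatten_mapP[i _].
case/msuppM_le/allpairsP => [[m1 m2] /= [_ /(gen_homogeneous P) d2 ->]].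
by rewrite mdegD d2 leq_addl.
Qed.

Lemma syz_row t : \sum_i M t i * f i = 0.
Proof.
apply/(syz_generate P); exists (fun j => (t == j)%:R) => i.
rewrite (bigD1 t) //= eqxx mul1r big1 ?addr0 // => j ne_ji.
by rewrite eq_sym (negbTE ne_ji) mul0r.
Qed.

(** Split the t-th syzygy by variables: \sum_k 'X_k * h k = 0 with every h k a
form of degree q in I. The coefficient of syz_coeff u t at 'X_e is that of h e
at u. It contributes to the monomial u + e of the sum, where it has to cancel
against a term of some other 'X_k * h k. *)
Lemma syz_coeff_exchange u t e : mdeg u = q -> (syz_coeff u t)@_U_(e)%MM != 0 ->
  exists k h (w : 'X_{1..n}), [/\ k <> e, (u + U_(e) = w + U_(k))%MM, h \in I,
    w \in msupp h & mdeg w = q].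
Proof.
move=> du nz; pose h k : S := \sum_i (M t i)@_U_(k)%MM *: f i.
have hI k : h k \in I.
  apply/(gen_ideal P); exists (fun i => ((M t i)@_U_(k)%MM)%:MP_[n]).
  by apply: eq_bigr => i _; rewrite mul_mpolyC.
have hom_h k : homogeneous q (h k).
  move=> m /msupp_sum_le/flatten_mapP[i _] /msuppZ_le; exact: gen_homogeneous P _ _.
have rel : \sum_k h k * 'X_k = 0.
  apply: etrans (syz_row t).
  under [RHS]eq_bigr => i _ do
    rewrite (homogeneous1E (syz_homogeneous P t i)) mulr_suml.
  rewrite exchange_big /=; apply: eq_bigr => k _; rewrite mulr_suml.
  by apply: eq_bigr => i _; rewrite -!scalerAl mulrC.
have he : (h e)@_u != 0.
  rewrite raddf_sum /=; move: nz; rewrite raddf_sum /=.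
  under eq_bigr do rewrite mcoeffZ mulrC.
  by under [in X in _ -> X]eq_bigr do rewrite mcoeffZ.
have [k ke hk] : exists2 k, k != e & (h k * 'X_k)@_(U_(e) + u)%MM != 0.
  apply/exists_inP; apply: contraR he => /exists_inPn no.
  have := congr1 (mcoeff (U_(e) + u)%MM) rel.
  rewrite raddf_sum mcoeff0 (bigD1 e) //= mcoeffMX big1 ?addr0 => [->//|k ne_ke].
  by apply/eqP; have := no k ne_ke; rewrite negbK.
have [w [m2 [Eu hw]]] := mcoeffM_neq0 hk; rewrite mcoeffX.
case: (U_(k)%MM =P m2) => [Em2 _|]; last by rewrite eqxx.
have ws : w \in msupp (h k) by rewrite mcoeff_msupp.
exists k, (h k), w; split=> //; first exact/eqP.
- by rewrite addmC Eu Em2.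
- exact: hom_h ws.
Qed.

(** With p1 = \sum a_i f_i and p2 = \sum b_i f_i, the row p2 a - p1 b is a
syzygy, hence a combination of the rows of M. Take the coefficient at u of
each generator: the entries a_i contribute p2 times a polynomial with constant
term p1@_u = 1, so the coefficient at m of the result is
p2@_m * 1 - 0 = 1. As a combination of the linear forms syz_coeff u t, the
result has only monomials divisible by a variable occurring in them. *)
Lemma koszul_monomial p1 p2 u m :
  p1 \in I -> p2 \in I -> homogeneous q p1 -> homogeneous q p2 ->
  mdeg u = q -> mdeg m = q ->
  p1@_u = 1 -> p1@_m = 0 -> p2@_m = 1 ->
  exists t e, (syz_coeff u t)@_U_(e)%MM != 0 /\ (0 < m e)%N.
Proof.
move=> /(gen_ideal P)[a Ea] /(gen_ideal P)[b Eb] hom1 hom2 du dm p1u p1m p2m.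
pose v i := a i * p2 - b i * p1.
have : \sum_i v i * f i = 0.
  under eq_bigr do rewrite mulrBl ![_ * _ * f _]mulrAC.
  by rewrite sumrB -!mulr_suml -Ea -Eb mulrC subrr.
case/(syz_generate P)=> y Ey.
have : (\sum_t y t * syz_coeff u t)@_m != 0.
  suff -> : \sum_t y t * syz_coeff u t = \sum_i (f i)@_u *: v i.
    rewrite raddf_sum /=.
    have -> : \sum_i ((f i)@_u *: v i)@_m = \sum_i (a i * f i)@_u.
      apply: eq_bigr => i _; rewrite mcoeffZ mcoeffB.
      rewrite !(mcoeffM_homogeneous _ _ dm) // p1m p2m mulr0 subr0 mulr1 mulrC.
      by rewrite (mcoeffM_homogeneous _ (gen_homogeneous P i) du).
    have := congr1 (mcoeff u) Ea; rewrite p1u raddf_sum /= => <-.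
    exact: oner_neq0.
  under [RHS]eq_bigr do rewrite Ey scaler_sumr.
  rewrite exchange_big /=; apply: eq_bigr => t _; rewrite mulr_sumr.
  by apply: eq_bigr => i _; rewrite scalerAr.
rewrite raddf_sum /= => nz.
have [t nzt] : exists t, (y t * syz_coeff u t)@_m != 0.
  apply/existsP; apply: contraR nz => /existsPn no.
  by rewrite big1 // => t _; apply/eqP; have := no t; rewrite negbK.
have [m1 [m2 [Em _ nz2]]] := mcoeffM_neq0 nzt.
have /eqP/mdeg1P[e /eqP E2] : mdeg m2 = 1%N.
  move: nz2; rewrite -mcoeff_msupp => /msupp_sum_le/flatten_mapP[i _] /msuppZ_le.
  exact: syz_homogeneous P _ _ _.
exists t, e; rewrite -E2 nz2; split=> //.
by rewrite Em E2 mnmDE mnm1E eqxx addn1.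
Qed.

End LinearPresentation.

(** When D is too short the shifts of F_1 or F_2 are the empty list, and the
corresponding families are empty. *)
Lemma has_linear_presentation q (I : {pred S}) :
  has_linear_resolution q I ->
  exists r s (f : 'I_r -> S) (M : 'I_s -> 'I_r -> S),
    linear_presentation q I f M.
Proof.
case=> D [phi [res lin]].
have shiftE i (j : 'I_(size (shifts D i.+1))) :
    nth 0%N (shifts D i.+1) j = (q + i)%N.
  have lt_i : (i < size D)%N.
    rewrite ltnNge; apply/negP => le_i.
    by case: j => j /=; rewrite /shifts /= nth_default.
  apply/eqP/negPn/negP => /eqP ne.
  have /(lin i.+1) : (1 <= i.+1 <= size D)%N by [].
  move/(_ (nth 0%N (shifts D i.+1) j)); rewrite addnS subn1 => /(_ ne) /eqP.
  rewrite /betti -leqn0 leqNgt -has_count has_pred1 mem_nth //.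
exists (size (shifts D 1)), (size (shifts D 2)).
exists (fun i => phi 0%N i ord0), (fun t i => phi 1%N t i).
have mulE (v : 'rV[S]_(size (shifts D 1))) p :
    v *m phi 0%N = const_mx p :> 'rV_1 <-> p = \sum_i v 0 i * phi 0%N i ord0.
  split=> [/matrixP/(_ 0 ord0)|Ep]; first by rewrite !mxE.
  by apply/matrixP => i j; rewrite !mxE !ord1 Ep.
split.
- move=> i m /(res_graded res) /=; rewrite shiftE !addn0; exact.
- move=> p; split=> [/(res_coker res)[w /mulE ->]|[w Ep]].
    by exists (fun i => w 0 i).
  apply/(res_coker res); exists (\row_i w i); apply/mulE.
  by rewrite Ep; apply: eq_bigr => i _; rewrite mxE.
- move=> t i m /(res_graded res); rewrite !shiftE addn0 addn1; lia.
move=> v; pose V : 'rV[S]_(size (shifts D 1)) := \row_i v i.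
have VE : V *m phi 0%N = 0 <-> 0 = \sum_i v i * phi 0%N i ord0.
  have -> : \sum_i v i * phi 0%N i ord0 = \sum_i V 0 i * phi 0%N i ord0.
    by apply: eq_bigr => i _; rewrite mxE.
  exact: mulE V 0.
split=> [Ev|[y Ey]].
  have /(res_exact res)[w Ew] : V *m phi 0%N = 0 by apply/VE.
  exists (fun t => w 0 t) => i.
  by have := congr1 (fun A : 'rV[S]_(size (shifts D 1)) => A 0 i) Ew; rewrite !mxE.
apply/esym/VE/(res_exact res); exists (\row_t y t); apply/rowP => i.
by rewrite !mxE Ey; apply: eq_bigr => t _; rewrite mxE.
Qed.

End Coefficients.

(** * The toric ideal of a bipartite graph *)

Lemma bipartite_endpoints N (G : sgraph N) : bipartite G ->
  exists (A : {set 'I_N}) (L R : 'I_(nedges G) -> 'I_N),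
    forall k, [/\ L k \in A, R k \notin A & edge k = [set L k; R k]].
Proof.
case=> A Aadj; exists A.
have /fin_all_exists[LR LRP] : forall k : 'I_(nedges G), exists xy : 'I_N * 'I_N,
    [/\ xy.1 \in A, xy.2 \notin A & edge k = [set xy.1; xy.2]].
  move=> k; have := enum_valP k; rewrite -/(edge k).
  case/imsetP=> -[x y]; rewrite inE /= => /Aadj ne_xy E.
  have [Ax|nAx] := boolP (x \in A).
    by exists (x, y); rewrite Ax in ne_xy; case: (y \in A) ne_xy.
  exists (y, x); rewrite (negbTE nAx) in ne_xy.
  by split=> //=; [case: (y \in A) ne_xy | rewrite setUC].
by exists (fst \o LR), (snd \o LR).
Qed.

Section BipartiteToricIdeal.
Variables (K : fieldType) (N : nat) (G : sgraph N).
Variables (A : {set 'I_N}) (L R : 'I_(nedges G) -> 'I_N).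
Hypothesis endpoints :
  forall k, [/\ L k \in A, R k \notin A & edge k = [set L k; R k]].
Implicit Types (u v m : 'X_{1..nedges G}).

Lemma endpoints_inj k l : L k = L l -> R k = R l -> k = l.
Proof.
move=> EL ER; have [_ _ Ek] := endpoints k; have [_ _ El] := endpoints l.
by apply: enum_val_inj; rewrite -/(edge k) -/(edge l) Ek El EL ER.
Qed.

Definition vertex_degree u : 'X_{1..N} := (\sum_k rho (edge k) *+ u k)%MM.

Lemma vertex_degreeE u x :
  vertex_degree u x = (endpoint_degree L u x + endpoint_degree R u x)%N.
Proof.
rewrite mnm_sumE /endpoint_degree [X in _ = (X + _)%N]big_mkcond.
rewrite [X in _ = (_ + X)%N]big_mkcond -big_split.
apply: eq_bigr => k _ /=; rewrite mulmnE.
have [Lk Rk ->] := endpoints k.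
have ne_LR : L k \notin [set R k].
  by rewrite inE; apply: contraNneq Rk => <-.
rewrite /rho big_setU1 //= big_set1 mnmDE !mnm1E mulnDl !mulnbl.
by congr (_ + _)%N; case: eqP.
Qed.

(** The colour class A tells whether a vertex degree counts left or right
endpoints. *)
Lemma vertex_degree_cong u v :
  vertex_degree u = vertex_degree v <-> cong L R u v.
Proof.
split=> [E|[EL ER]]; last by apply/mnmP => x; rewrite !vertex_degreeE EL ER.
have Ex x : (endpoint_degree L u x + endpoint_degree R u x
    = endpoint_degree L v x + endpoint_degree R v x)%N.
  by rewrite -!vertex_degreeE E.
have L0 w x : x \notin A -> endpoint_degree L w x = 0%N.
  move=> nAx; rewrite /endpoint_degree big1 // => k /eqP Lk.
  by have [] := endpoints k; rewrite Lk (negbTE nAx).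
have R0 w x : x \in A -> endpoint_degree R w x = 0%N.
  move=> Ax; rewrite /endpoint_degree big1 // => k /eqP Rk.
  by have [] := endpoints k; rewrite Rk Ax.
split=> x; have := Ex x; have [Ax|nAx] := boolP (x \in A).
- by rewrite !R0 // !addn0.
- by rewrite !L0.
- by rewrite !R0.
- by rewrite !L0.
Qed.

Lemma mmap1_edge_monomial u :
  mmap1 (@edge_monomial K N G) u = 'X_[vertex_degree u] *: 'X^(mdeg u).
Proof.
rewrite /mmap1; under eq_bigr do rewrite exprZn mpolyXn.
rewrite scaler_prod prodrXr mdegE /vertex_degree; congr (_ *: _).
by rewrite (big_morph _ (@mpolyXD _ _) (@mpolyX0 _ _)).
Qed.

Lemma toric_map_coef p (d : nat) (e : 'X_{1..N}) :
  ((toric_map K G p)`_d)@_e =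
  \sum_(m <- msupp p | (vertex_degree m == e) && (mdeg m == d)) p@_m.
Proof.
rewrite /toric_map /mmap coef_sum raddf_sum /= [RHS]big_mkcond /=.
apply: eq_bigr => m _; rewrite mmap1_edge_monomial coefCM coefZ coefXn.
rewrite mcoeffCM [d == _]eq_sym; case: (mdeg m == d); last first.
  by rewrite mulr0 mcoeff0 mulr0 andbF.
by rewrite mulr1 mcoeffX andbT; case: eqP => _; rewrite ?mulr1 ?mulr0.
Qed.

(** The images of the monomials congruent to m are equal, and distinct from
those of all others, so the coefficients over this class add up to 0. *)
Lemma toric_ideal_partner p m : p \in toric_ideal K G -> m \in msupp p ->
  exists m', [/\ m' \in msupp p, m' <> m & cong L R m m'].
Proof.
rewrite inE => /eqP Ip mp.
have := toric_map_coef p (mdeg m) (vertex_degree m); rewrite Ip coef0 mcoeff0.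
rewrite -big_filter; set T := [seq _ <- _ | _].
have mT : m \in T by rewrite mem_filter !eqxx.
rewrite (bigD1_seq m) ?filter_uniq ?msupp_uniq //=.
have [/hasP[m' m'T /eqP ne]|/hasPn no] := boolP (has (predC1 m) T).
  move: m'T; rewrite mem_filter => /andP[/andP[/eqP E _] m'p] _.
  by exists m'; split=> //; apply/vertex_degree_cong/esym.
rewrite big1_seq => [/esym/eqP|m' /andP[ne /no /=]]; last by rewrite ne.
by rewrite addr0 mcoeff_eq0 mp.
Qed.

Lemma toric_ideal_binomial u v : cong L R u v ->
  'X_[u] - 'X_[v] \in toric_ideal K G.
Proof.
move=> Cuv; rewrite inE /toric_map raddfB /= !mmapX !mmap1_edge_monomial.
by rewrite (cong_mdeg Cuv) (proj2 (vertex_degree_cong u v) Cuv) subrr.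
Qed.

Section Linear.
Variables (q r s : nat).
Variables (f : 'I_r -> {mpoly K[nedges G]}).
Variables (M : 'I_s -> 'I_r -> {mpoly K[nedges G]}).
Hypothesis P : linear_presentation q (toric_ideal K G) f M.

(** The binomial of a congruent pair lies in I, and the elements of I have no
monomial of degree less than q. *)
Lemma cong_small_eq u v : cong L R u v -> (mdeg u < q)%N -> u = v.
Proof.
move=> Cuv du; apply/eqP; apply: contraTT du => /negbTE ne_uv.
rewrite -leqNgt; apply: (ideal_mdeg_ge P (toric_ideal_binomial Cuv)).
by rewrite mcoeff_msupp mcoeffB !mcoeffX eqxx [v == u]eq_sym ne_uv subr0 oner_eq0.
Qed.

Lemma homogeneous_binomial u v : mdeg u = q -> cong L R u v ->
  homogeneous q ('X_[u] - 'X_[v] : {mpoly K[nedges G]}).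
Proof.
move=> du Cuv m /msuppB_le; rewrite !msuppX mem_cat !inE.
by case/orP=> /eqP ->; rewrite // -(cong_mdeg Cuv).
Qed.

Lemma koszul_edge u v w w' :
  nontrivial_cong L R q u v -> nontrivial_cong L R q w w' -> ~ cong L R u w ->
  exists t e, (syz_coeff f M u t)@_U_(e)%MM != 0 /\ (0 < w e)%N.
Proof.
move=> [Cuv ne_uv du] [Cww' ne_ww' dw] nCuw.
have neq (a b : 'X_{1..nedges G}) : a <> b -> (a == b) = false by move/eqP/negbTE.
apply: (koszul_monomial P (toric_ideal_binomial Cuv) (toric_ideal_binomial Cww')
  (homogeneous_binomial du Cuv) (homogeneous_binomial dw Cww') du dw);
  rewrite mcoeffB !mcoeffX.
- by rewrite eqxx neq ?subr0 //; apply: nesym.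
- rewrite !neq ?subr0 //.
    by move=> Evw; apply: nCuw; rewrite -Evw.
  by move=> Euw; apply: nCuw; rewrite -Euw; split.
- by rewrite eqxx neq ?subr0 //; apply: nesym.
Qed.

Lemma syz_coeff_nontrivial_exchange u t e :
  mdeg u = q -> (syz_coeff f M u t)@_U_(e)%MM != 0 ->
  exists k w w', [/\ k <> e, (u + U_(e) = w + U_(k))%MM
    & nontrivial_cong L R q w w'].
Proof.
move=> du /(syz_coeff_exchange P du)[k [h [w [ke exch hI wh dw]]]].
have [w' [_ ne Cww']] := toric_ideal_partner hI wh.
by exists k, w, w'; split=> //; split=> //; apply: nesym.
Qed.

(** Two independent relations would have a Koszul syzygy that linear syzygies
do not generate: the first use of koszul_edge produces an exchange from u to a
relation x, x', the second one an edge of x' away from the cycle of u, which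
exchange_touch excludes. *)
Lemma nontrivial_cong_same_fiber u v w w' : (3 <= q)%N ->
  nontrivial_cong L R q u v -> nontrivial_cong L R q w w' -> cong L R u w.
Proof.
move=> q_ge3 uv ww'; have [Cuv _ du] := uv.
apply/vertex_degree_cong/eqP/negPn/negP => /eqP ne.
have nCuw : ~ cong L R u w by move/vertex_degree_cong.
have [t0 [e0 [nz0 _]]] := koszul_edge uv ww' nCuw.
have [k [x [x' [ke exch xx']]]] := syz_coeff_nontrivial_exchange du nz0.
have nCux' : ~ cong L R u x'.
  have [Cxx' _ _] := xx' => Cux'; have [EL ER] := cong_trans Cux' (cong_sym Cxx').
  apply: ke; apply: endpoints_inj.
    have := exchange_degree exch L (L e0); rewrite EL eqxx => /addnI.
    by case: eqP.
  have := exchange_degree exch R (R e0); rewrite ER eqxx => /addnI.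
  by case: eqP.
have [t [e [nz x'e]]] := koszul_edge uv (nontrivial_cong_sym xx') nCux'.
have [k' [y [y' [k'e exch' yy']]]] := syz_coeff_nontrivial_exchange du nz.
have [Lu0 Ru0] :=
  exchange_edge_disjoint q_ge3 endpoints_inj cong_small_eq uv yy' k'e exch'.
exact (exchange_touch endpoints_inj cong_small_eq xx' ke exch x'e Lu0 Ru0).
Qed.

Lemma toric_ideal_gen_eq (g : {mpoly K[nedges G]}) :
  (forall i, exists c, f i = c * g) -> g \in toric_ideal K G ->
  principal_ideal (toric_ideal K G).
Proof.
move=> /fin_all_exists[c fE] gI; exists g => p.
split=> [/(gen_ideal P)[w ->]|[h ->]].
  exists (\sum_i w i * c i); rewrite mulr_suml.
  by apply: eq_bigr => i _; rewrite {1}fE mulrA.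
have /(gen_ideal P)[w Eg] := gI; apply/(gen_ideal P).
exists (fun i => h * w i); rewrite Eg mulr_sumr.
by apply: eq_bigr => i _; rewrite mulrA.
Qed.

(** Let u be the leading exponent of a nonzero generator, and v its partner.
Subtracting a multiple of 'X_[u] - 'X_[v] from any generator gives g in I
without the monomial u. A monomial of g would be congruent to u, hence equal
to v, and so would its partner in g. *)
Lemma linear_presentation_principal :
  (3 <= q)%N -> principal_ideal (toric_ideal K G).
Proof.
move=> q_ge3; case: (pickP (fun i => f i != 0)) => [i fi_neq0|f0]; last first.
  apply: (@toric_ideal_gen_eq 0) => [i|]; last by rewrite inE /toric_map mmap0.
  by exists 0; rewrite mulr0; apply/eqP; have /negbFE := f0 i.
pose u := mlead (f i).
have fu : u \in msupp (f i) by rewrite mlead_supp.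
have du : mdeg u = q by exact: gen_homogeneous P i _ fu.
have [v [_ ne_vu Cuv]] := toric_ideal_partner (gen_mem P i) fu.
have uv : nontrivial_cong L R q u v by split=> //; apply: nesym.
apply: (@toric_ideal_gen_eq ('X_[u] - 'X_[v])); last exact: toric_ideal_binomial.
move=> j; exists ((f j)@_u)%:MP_[nedges G].
set p := 'X_[u] - 'X_[v]; pose g := f j - ((f j)@_u)%:MP_[nedges G] * p.
apply/eqP; rewrite -subr_eq0 -/g; apply/eqP/msuppnil0.
have gI : g \in toric_ideal K G.
  by apply: (ideal_subM P) (gen_mem P j) _; apply: toric_ideal_binomial.
have hom_g : homogeneous q g.
  move=> m /msuppB_le; rewrite mem_cat => /orP[/(gen_homogeneous P)//|].
  by rewrite mul_mpolyC => /msuppZ_le; apply: homogeneous_binomial.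
have gu : g@_u = 0.
  rewrite mcoeffB mcoeffCM mcoeffB !mcoeffX eqxx.
  by move/eqP/negbTE: ne_vu => ->; rewrite subr0 mulr1 subrr.
case Eg : (msupp g) => [//|m ms]; exfalso.
have gm : m \in msupp g by rewrite Eg mem_head.
have [m' [gm' ne_m'm Cmm']] := toric_ideal_partner gI gm.
have neq_u x : x \in msupp g -> x <> u.
  by rewrite mcoeff_msupp => + E; rewrite E gu eqxx.
have mm' : nontrivial_cong L R q m m'.
  by split=> //; [apply: nesym | apply: hom_g].
have Cum := nontrivial_cong_same_fiber q_ge3 uv mm'.
apply: ne_m'm.
rewrite (nontrivial_cong_unique endpoints_inj cong_small_eq uv Cum (neq_u _ gm)).
apply: (nontrivial_cong_unique endpoints_inj cong_small_eq uv _ (neq_u _ gm')).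
exact: cong_trans Cum Cmm'.
Qed.

End Linear.
End BipartiteToricIdeal.

Theorem theorem0p2 (K : fieldType) (q : nat) (N : nat) (G : sgraph N) :
  (3 <= q)%N -> connected G -> bipartite G ->
  edge_ring_linear K G q -> edge_ring_hypersurface K G.
Proof.
move=> q_ge3 _ /bipartite_endpoints[A [L [R endpoints]]].
case/has_linear_presentation=> r [s [f [M P]]].
exact: (linear_presentation_principal endpoints P q_ge3).
Qed.
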